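(* Suppose that $X\subset\mathbb{R}^2$ is a finite subset, $d\ge 2$, and $\mathcal{R}(X)$ contains a $d$-dimensional normal pseudomanifold $K$ as an induced subcomplex. Then $K$ is isomorphic (as a simplicial complex) to the boundary of the $(d+1)$-dimensional crosspolytope.
   Context: For a subset $X\subseteq\mathbb{R}^n$ (with the Euclidean metric), the Rips complex $\mathcal{R}(X)$ (at distance scale $1$) is the abstract simplicial complex with vertex set $X$ in which a finite nonempty set $Y\subseteq X$ is a face if and only if its Euclidean diameter is less than $1$. A subcomplex $K$ of a simplicial complex $L$ is induced if every face of $L$ all of whose vertices lie in $K$ is a face of $K$. A $d$-dimensional normal pseudomanifold is a pure (all maximal faces have dimension $d$), connected simplicial complex of dimension $d$ such that every $(d-1)$-dimensional face is contained in precisely two $d$-dimensional faces and the link of every face of dimension at most $d-2$ is connected. The boundary of the $(d+1)$-dimensional crosspolytope is the simplicial complex with $2(d+1)$ vertices $\pm e_1,\dots,\pm e_{d+1}$ whose faces are the vertex sets containing no antipodal pair $\{e_i,-e_i\}$. *)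

(* Defs.v *)
From mathcomp Require Import all_boot all_order all_algebra.
From mathcomp Require Import finmap.
From mathcomp Require Import boolp classical_sets functions cardinality reals.
From Stdlib Require Import Relation_Operators.

Set Implicit Arguments.
Unset Strict Implicit.
Unset Printing Implicit Defensive.

Import Order.TTheory GRing.Theory Num.Theory.

Local Open Scope classical_set_scope.
Local Open Scope fset_scope.
Local Open Scope ring_scope.

(* The empty set is not a face. Points of T need not be vertices of the
   complex: see vertices below. *)
Record complex (T : choiceType) := Complex {
  face :> set {fset T};
  face_neq0 : forall A, face A -> A != fset0;
  face_sub : forall A B, face B -> A != fset0 -> A `<=` B -> face A }.

Section Complexes.
Variable T : choiceType.
Implicit Types (K L : complex T) (A B C : {fset T}).

Definition vertices K : set T := [set v | face K [fset v]].

Definition subcomplex K L : Prop := forall A, face K A -> face L A.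

Definition induced_subcomplex K L : Prop :=
  subcomplex K L /\
  forall A, face L A -> (forall v, v \in A -> vertices K v) -> face K A.

(* Only meaningful for nonempty A: the predecessor is truncated. *)
Definition fdim A : nat := #|` A|.-1.

Definition maximal_face K A : Prop :=
  face K A /\ forall B, face K B -> A `<=` B -> B = A.

Definition has_dim K (d : nat) : Prop :=
  (exists A, face K A /\ fdim A = d) /\
  (forall A, face K A -> (fdim A <= d)%N).

Definition pure K (d : nat) : Prop :=
  forall A, maximal_face K A -> fdim A = d.

(* A complex is connected when its 1-skeleton is a connected graph; a loop
   [fset x; x] is the vertex x itself. In a pure d-dimensional complex the
   link of a face of dimension at most d - 2 is nonempty, so whether the empty
   complex counts as connected is immaterial below. *)
Definition connected_complex K : Prop :=
  forall u v, vertices K u -> vertices K v ->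
    clos_refl_trans T (fun x y => face K [fset x; y]) u v.

Definition link_face K A : set {fset T} :=
  [set B | [/\ B != fset0, [disjoint A & B] & face K (A `|` B)]].

Lemma link_face_neq0 K A B : link_face K A B -> B != fset0.
Proof. by case. Qed.

Lemma link_face_sub K A B C :
  link_face K A C -> B != fset0 -> B `<=` C -> link_face K A B.
Proof.
move=> [_ dAC KAC] B0 BC; split => //.
  by rewrite (fdisjointWr BC dAC).
apply: face_sub KAC _ (fsetUS A BC).
by apply: contra B0; rewrite fsetU_eq0 => /andP[].
Qed.

Definition link K A : complex T :=
  Complex (@link_face_neq0 K A) (@link_face_sub K A).

Definition normal_pseudomanifold (d : nat) K : Prop :=
  [/\ has_dim K d,
      pure K d,
      connected_complex K,
      (forall A, face K A -> (fdim A).+1 = d ->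
         exists B1 B2, B1 <> B2 /\
           forall B, [/\ face K B, fdim B = d & A `<=` B]
             <-> B = B1 \/ B = B2) &
      (forall A, face K A -> ((fdim A).+2 <= d)%N ->
         connected_complex (link K A))].

End Complexes.

Definition isomorphic (T U : choiceType) (K : complex T) (L : complex U) : Prop :=
  exists f : T -> U,
    set_bij (vertices K) (vertices L) f /\
    forall A : {fset T}, (forall v, v \in A -> vertices K v) ->
      (face K A <-> face L (f @` A)%fset).

Section Rips.
Variables (R : realType) (n : nat).

(* The library's norm on 'rV[R]_n is the sup norm, so the Euclidean distance
   is spelled out. *)
Definition edist (x y : 'rV[R]_n) : R :=
  Num.sqrt (\sum_(i < n) (x ord0 i - y ord0 i) ^+ 2).

Definition diam (A : {fset 'rV[R]_n}) : R :=
  \big[Num.max/0]_(x <- A) \big[Num.max/0]_(y <- A) edist x y.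

Variable X : set 'rV[R]_n.

Definition rips_face : set {fset 'rV[R]_n} :=
  [set A | [/\ A != fset0, (forall x, x \in A -> X x) & diam A < 1]].

Lemma rips_face_neq0 A : rips_face A -> A != fset0.
Proof. by case. Qed.

Lemma rips_face_sub A B :
  rips_face B -> A != fset0 -> A `<=` B -> rips_face A.
Proof.
move=> [_ BX dB] A0 /fsubsetP AB; split => // [x /AB /BX //|].
have dist_lt x y : x \in A -> y \in A -> edist x y < 1.
  move=> /AB xB /AB yB; apply: le_lt_trans dB.
  rewrite /diam; apply: (@bigmax_sup_seq _ _ _ _ _ x) => //.
  exact: (@bigmax_sup_seq _ _ _ _ _ y).
rewrite /diam big_seq; apply: bigmax_lt => // x xA.
by rewrite big_seq; apply: bigmax_lt => // y yA; exact: dist_lt.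
Qed.

Definition rips : complex 'rV[R]_n :=
  Complex rips_face_neq0 rips_face_sub.

End Rips.

Section Crosspolytope.
Variable m : nat.

(* (i, true) stands for e_i and (i, false) for - e_i. *)
Definition antipode (v : 'I_m * bool) : 'I_m * bool := (v.1, ~~ v.2).

Definition cross_face : set {fset 'I_m * bool} :=
  [set A | A != fset0 /\ forall v, v \in A -> antipode v \notin A].

Lemma cross_face_neq0 A : cross_face A -> A != fset0.
Proof. by case. Qed.

Lemma cross_face_sub A B :
  cross_face B -> A != fset0 -> A `<=` B -> cross_face A.
Proof.
move=> [_ Bv] A0 /fsubsetP AB; split => // v /AB /Bv.
by apply: contra => /AB.
Qed.

(* The boundary of the m-dimensional crosspolytope. *)
Definition crosspolytope_boundary : complex ('I_m * bool)%type :=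
  Complex cross_face_neq0 cross_face_sub.

End Crosspolytope.

(* Main.v *)
Require Import Defs.
From mathcomp Require Import all_boot all_order all_algebra.
From mathcomp Require Import finmap.
From mathcomp Require Import boolp classical_sets functions cardinality reals.
From mathcomp Require Import zify ring lra.
From Stdlib Require Import Relation_Operators.

Set Implicit Arguments.
Unset Strict Implicit.
Unset Printing Implicit Defensive.

Import Order.TTheory GRing.Theory Num.Theory.

Local Open Scope fset_scope.
Local Open Scope ring_scope.

(** By flagness everything is about the graph of points at distance less than 1.
    Links reduce the statement to d = 2: if all vertex links of a connected
    complex are boundaries of crosspolytopes, so is the complex. In dimension 2
    there is no K4, hence no vertex lies in a closed triangle of the surface
    and, by the triangle inequality, edges of one vertex link never cross. If
    the two triangles on an edge p1 p2 lie on the same side of it (a crease),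
    with apexes p0 and p3 in convex position p0 p1 p2 p3, then the whole link
    of p1 lies in the angle p0 p1 p2, so p0 p1 is again a crease, with apexes m
    and p2. A fifth neighbour v of p1 would be seen through the edge p0 p2;
    then the segment p1 v crosses a second side of the other triangle on
    p0 p2, which makes v adjacent to p0 or p2: impossible. So the link of p1 is
    the 4-cycle p0 p2 p3 m, all of whose vertices lie on creases, and this
    property spreads along the connected graph. A vertex farthest from the
    origin lies on a crease. *)

(** * Graphs whose iterated links are spheres, and cocktail-party graphs *)

Section Graphs.
Variables (T : choiceType) (e : rel T).
Hypotheses (e_sym : symmetric e) (e_irr : irreflexive e).
Implicit Types (S : {fset T}) (u v w : T).

Definition nbhd S v : {fset T} := [fset u in S | e v u].

(** Connectedness is stated as an induction principle, the form in which properties of vertices are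
    spread along edges. *)
Definition connected S : Prop :=
  forall P : T -> Prop, (exists2 u, u \in S & P u) ->
    (forall u v, u \in S -> v \in S -> P u -> e u v -> P v) ->
    forall v, v \in S -> P v.

(** The graph of a flag normal pseudomanifold of dimension [d]: two non-adjacent points for 0, a
    cycle of length at least 4 for 1, a flag closed surface for 2. *)
Fixpoint locally_sphere (d : nat) S : Prop :=
  if d is d'.+1 then
    [/\ S != fset0, connected S & forall v, v \in S -> locally_sphere d' (nbhd S v)]
  else exists u v, [/\ u != v, ~~ e u v & S = [fset u; v]].

(* The graph of a crosspolytope: the complement of a perfect matching. *)
Definition cocktail_party S : Prop :=
  forall v, v \in S -> exists w, [/\ w \in S, w != v, ~~ e v w &
    forall u, u \in S -> u != v -> u != w -> e v u].

Lemma in_nbhd S v u : (u \in nbhd S v) = (u \in S) && e v u.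
Proof. by rewrite !inE. Qed.

Lemma edge_neq u v : e u v -> u != v.
Proof. by move=> euv; apply/eqP => uv; rewrite uv e_irr in euv. Qed.

(** In the link of each neighbour [a] of [v], the vertex [v] has an antipode [w]. This [w] turns out
    not to depend on [a], and then [v], [w] and the neighbours of [v] form a set closed under
    adjacency. *)
Lemma cocktail_party_from_links S :
  S != fset0 -> connected S ->
  (forall v, v \in S -> cocktail_party (nbhd S v)) ->
  (forall v, v \in S -> nbhd S v != fset0) ->
  (forall v u, v \in S -> u \in nbhd S v -> nbhd (nbhd S v) u != fset0) ->
  cocktail_party S /\ forall v, v \in S -> #|` S| = (#|` nbhd S v|.+2)%N.
Proof.
move=> S0 conS linkS nbhd0 link0.
have apex v : v \in S -> exists w, [/\ w \in S, w != v, ~~ e v w &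
    forall a, a \in S -> e v a -> e a w /\
     forall u, u \in S -> e a u -> u != v -> u != w -> e v u].
  move=> vS.
  have anti a : a \in S -> e v a -> exists w, [/\ w \in S, w != v, ~~ e v w, e a w &
     forall u, u \in S -> e a u -> u != v -> u != w -> e v u].
    move=> aS eva; have vN : v \in nbhd S a by rewrite in_nbhd vS e_sym.
    case: (linkS a aS v vN) => w; rewrite in_nbhd => -[/andP[wS eaw] wv vw univ].
    exists w; split=> // u uS eau; apply: univ.
    by rewrite in_nbhd uS.
  (* In the link of [a] the antipode of [w] can only be [v], so any other vertex [b] of that link is
     adjacent to [w]. *)
  have anti_adj a b w : a \in S -> b \in S -> e v a -> e v b -> e a b -> 
     w \in S -> e a w -> w != v -> ~~ e v w -> e b w.
    move=> aS bS eva evb eab wS eaw wv vw.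
    have wN : w \in nbhd S a by rewrite in_nbhd wS.
    case: (linkS a aS w wN) => z; rewrite in_nbhd => -[/andP[zS eaz] zw wz univ].
    have bw : b != w by apply: contraNneq vw => <-.
    have vz : v = z.
      apply/eqP; apply: contraNT vw => vz; rewrite e_sym.
      by apply: univ; rewrite ?in_nbhd ?vS // 1?e_sym // eq_sym.
    rewrite e_sym; apply: univ => //; first by rewrite in_nbhd bS.
    by rewrite -vz eq_sym edge_neq.
  have [a aN] : exists a, a \in nbhd S v by apply/fset0Pn/nbhd0.
  have [aS eva] : a \in S /\ e v a by apply/andP; rewrite -in_nbhd.
  case: (anti a aS eva) => w [wS wv vw eaw univ].
  exists w; split=> // b bS evb.
  have ebw : e b w.
    have [ba|ba] := eqVneq b a; first by rewrite ba.
    have [eab|nab] := boolP (e a b); first exact: (anti_adj a b).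
    (* Non-adjacent [a] and [b] are antipodal in the link of [v]; a third vertex [c] of this link is
       adjacent to both and carries [w] from [a] to [b]. *)
    have [c cN] : exists c, c \in nbhd (nbhd S v) a by apply/fset0Pn/link0.
    move: cN; rewrite !in_nbhd => /andP[/andP[cS evc] eac].
    have ecw : e c w by apply: (anti_adj a c).
    have bN : b \in nbhd S v by rewrite in_nbhd bS.
    case: (linkS v vS b bN) => z; rewrite in_nbhd => -[/andP[zS evz] zb bz bun].
    have za : a = z.
      apply/eqP; apply: contraNT nab => az; rewrite e_sym.
      by apply: bun; rewrite ?in_nbhd ?aS // eq_sym.
    have ecb : e c b.
      rewrite e_sym; apply: bun; first by rewrite in_nbhd cS.
        by apply: contraNneq nab => <-.
      by rewrite -za eq_sym edge_neq.
    exact: (anti_adj c b).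
  split=> // u uS ebu uv uw.
  case: (anti b bS evb) => w' [w'S w'v vw' ebw' univ'].
  apply: (univ') => //; apply: contraNneq vw => uw'.
  by apply: univ'; rewrite // -uw' eq_sym.
have pairS v : v \in S -> exists w, [/\ w \in S, w != v, ~~ e v w &
    forall u, u \in S -> u != v -> u != w -> e v u].
  move=> vS; case: (apex v vS) => w [wS wv vw univ].
  exists w; split=> //.
  have [a aN] : exists a, a \in nbhd S v by apply/fset0Pn/nbhd0.
  have [aS eva] : a \in S /\ e v a by apply/andP; rewrite -in_nbhd.
  have [eaw _] := univ a aS eva.
  case: (apex w wS) => v' [v'S v'w wv' univ'].
  (* Being antipodal is symmetric: [v] and [w] both lie in the link of [a] and are not adjacent. *)
  have vv' : v = v'.
    have ewa : e w a by rewrite e_sym.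
    have [_ /(_ v vS)] := univ' a aS ewa.
    rewrite e_sym eva eq_sym wv (e_sym w) (negPf vw) => /(_ isT isT) h.
    by apply/eqP; apply: contraT => /h.
  suff : forall u, u \in S -> [|| u == v, u == w | e v u].
    by move=> h u /h /or3P[/eqP->|/eqP->|//]; rewrite eqxx.
  apply: conS; first by exists v; rewrite ?eqxx.
  move=> x u xS uS hx exu; have [//|uv] := eqVneq u v.
  have [//|uw /=] := eqVneq u w.
  case/or3P: hx => [/eqP xv|/eqP xw|evx]; first by rewrite -xv.
    have ewu : e w u by rewrite -xw.
    have [+ _] := univ' u uS ewu; by rewrite -vv' e_sym.
  by have [_] := univ x xS evx; apply.
split=> // v vS; case: (pairS v vS) => w [wS wv vw univ].
have -> : S = v |` (w |` nbhd S v).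
  apply/fsetP => u; rewrite !inE.
  have [->|uv] := eqVneq u v; first by rewrite vS.
  have [->|uw] := eqVneq u w; first by rewrite wS.
  by case: (boolP (u \in S)) => //= uS; rewrite univ.
rewrite !cardfsU1; have -> : nbhd (v |` (w |` nbhd S v)) v = nbhd S v.
  apply/fsetP => u; rewrite !inE.
  have [->|uv] := eqVneq u v; first by rewrite e_irr vS.
  by have [->|uw] := eqVneq u w; rewrite ?(negPf vw) ?andbF //= -andbA andbb.
by rewrite !inE e_irr (negPf vw) !andbF eq_sym (negPf wv).
Qed.

Lemma edge_link S a b : locally_sphere 2 S -> a \in S -> b \in S -> e a b ->
  exists c c', [/\ c != c', ~~ e c c' &
    forall w, (w \in S) && e a w && e b w = (w == c) || (w == c')].
Proof.
move=> [_ _ lk] aS bS eab; case: (lk a aS) => _ _ /(_ b).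
rewrite in_nbhd bS => /(_ eab)[c [c' [cc' ncc' eqN]]]; exists c, c'; split=> // w.
by have /fsetP/(_ w) := eqN; rewrite !inE.
Qed.

Lemma other_neighbour S a b c : locally_sphere 2 S ->
  a \in S -> b \in S -> c \in S -> e a b -> e a c -> e b c ->
  exists c', [/\ c' \in S, e a c', e b c', c' != c & ~~ e c c'] /\
    forall w, w \in S -> e a w -> e b w -> w = c \/ w = c'.
Proof.
move=> hS aS bS cS eab eac ebc.
have [x [y [xy nxy h]]] := edge_link hS aS bS eab.
have mem w : w \in S -> e a w -> e b w -> w = x \/ w = y.
  by move=> wS eaw ebw; have := h w; rewrite wS eaw ebw => /esym/orP[]/eqP; tauto.
have := h x; rewrite eqxx => /andP[/andP[xS eax] ebx].
have := h y; rewrite eqxx orbT => /andP[/andP[yS eay] eby].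
case: (mem c cS eac ebc) => ->; [exists y | exists x]; split => //.
  by split; rewrite // eq_sym.
by split; rewrite // e_sym.
by move=> w wS aw bw; case: (mem w wS aw bw); tauto.
Qed.

Lemma common_neighbours S a b c c' w : locally_sphere 2 S ->
  a \in S -> b \in S -> e a b -> c != c' ->
  c \in S -> e a c -> e b c -> c' \in S -> e a c' -> e b c' ->
  w \in S -> e a w -> e b w -> w = c \/ w = c'.
Proof.
move=> hS aS bS eab cc' cS eac ebc c'S eac' ebc' wS eaw ebw.
have [x [y [xy _ h]]] := edge_link hS aS bS eab.
have := h c; have := h c'; have := h w; rewrite wS eaw ebw cS eac ebc c'S eac' ebc'.
move=> /esym/orP[]/eqP-> /esym/orP[]/eqP E /esym/orP[]/eqP E'; subst;
  rewrite ?eqxx in cc'; by [|left|right].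
Qed.

(** The common neighbours of an edge are two non-adjacent vertices, so [c] and [p] cannot both be
    among them. *)
Lemma no_K4 S a b c p : locally_sphere 2 S ->
  a \in S -> b \in S -> c \in S -> p \in S ->
  e a b -> e a c -> e b c -> e a p -> e b p -> e c p -> False.
Proof.
move=> hS aS bS cS pS eab eac ebc eap ebp ecp.
have [c' [[_ _ _ c'c ncc'] h]] := other_neighbour hS aS bS cS eab eac ebc.
case: (h p pS eap ebp) => pE; first by rewrite pE e_irr in ecp.
by rewrite -pE ecp in ncc'.
Qed.

Lemma surface_has_neighbour S v : locally_sphere 2 S -> v \in S ->
  exists2 a, a \in S & e v a.
Proof.
by move=> [_ _ lk] /lk[/fset0Pn[a]]; rewrite in_nbhd => /andP[]; exists a.
Qed.

Lemma handshake (s : seq T) : ~~ odd (\sum_(x <- s) \sum_(y <- s) e x y).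
Proof.
elim: s => [|v s IH]; first by rewrite big_nil.
rewrite big_cons big_cons e_irr add0n.
under [X in (_ + X)%N]eq_bigr => x _ do rewrite big_cons e_sym.
by rewrite big_split /= addnA oddD (negPf IH) oddD addbb.
Qed.

(* The link of x is a cycle. If P did not contain the second neighbour of b in
   it, then P would induce a graph with c as its only vertex of odd degree. *)
Lemma link_arc S x a b (P : pred T) : locally_sphere 2 S ->
  x \in S -> a \in S -> b \in S -> e x a -> e x b -> e a b ->
  ~~ P a -> ~~ P b ->
  (forall u v, u \in S -> v \in S -> e x u -> e x v -> e u v -> P u ->
     v != a -> v != b -> P v) ->
  (exists c, [/\ c \in S, e x c, e a c & P c]) ->
  forall w, w \in S -> e x w -> w != a -> w != b -> P w.
Proof.
move=> hS xS aS bS exa exb eab nPa nPb stepP [c [cS exc eac Pc]].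
have exs u v : e u v -> e v u by rewrite e_sym.
have cb : c != b by apply: contraNneq nPb => <-.
have [c' [[c'S _ _ c'c nbc] hxa]] := other_neighbour hS xS aS bS exa exb eab.
have {}hxa w : w \in S -> e x w -> e a w -> w = b \/ w = c.
  move=> wS exw eaw; case: (hxa w wS exw eaw); first tauto.
  case: (hxa c cS exc eac) => [/eqP|<-]; [by rewrite (negPf cb)|tauto].
have nebc : ~~ e b c.
  by apply/negP => ebc; apply: (no_K4 hS xS aS bS cS).
have [z [[zS exz ebz za naz] hxb]] :=
  other_neighbour hS xS bS aS exb exa (exs _ _ eab).
have Pz : P z.
  apply: contraT => nPz; pose s := [seq w <- S | e x w & P w].
  have memS w : (w \in s) = [&& w \in S, e x w & P w].
    by rewrite mem_filter andbC.
  have us : uniq s by rewrite filter_uniq.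
  have cs : c \in s by rewrite memS cS exc.
  have /negP[] := handshake s.
  rewrite (bigD1_seq c) //= oddD.
  have two w y y' : (forall v, v \in s -> e w v = (v == y) || (v == y')) ->
     y != y' -> (\sum_(v <- s) e w v = (y \in s) + (y' \in s))%N.
    move=> h yy'; rewrite -!(count_uniq_mem _ us) -!sum1_count.
    rewrite [X in (X + _)%N]big_mkcond [X in (_ + X)%N]big_mkcond /=.
    rewrite -big_split [LHS]big_seq [RHS]big_seq; apply: eq_bigr => v vs.
    rewrite h //=; have [->|] := eqVneq v y; first by rewrite (negPf yy').
    by case: (v == y').
  have deg w : w \in s -> exists y y', [/\ y != y',
      y \in S, y' \in S, (e x y /\ e x y') &
      (e w y /\ e w y') /\ forall v, v \in s -> e w v = (v == y) || (v == y')].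
    rewrite memS => /and3P[wS exw Pw].
    have [y [y' [yy' nyy' h]]] := edge_link hS xS wS exw.
    have := h y; rewrite eqxx => /andP[/andP[yS exy] ewy].
    have := h y'; rewrite eqxx orbT => /andP[/andP[y'S exy'] ewy'].
    exists y, y'; split=> //; split=> // v; rewrite memS -h => /and3P[-> -> _].
    by [].
  have nb w y : w \in s -> y \in S -> e x y -> e w y -> y != a -> y \in s.
    (* Only [b] could stop the propagation, but in the link the neighbours of [b] are [a] and [z],
       and [P] fails at both. *)
    rewrite !memS => /and3P[wS exw Pw] yS exy ewy ya; rewrite yS exy /=.
    apply: (stepP w y) => //; apply: contraNneq nPz => yb.
    have ebw : e b w by rewrite -yb e_sym.
    by case: (hxb w wS exw ebw) => [wa|<- //]; rewrite wa (negPf nPa) in Pw.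
  have nas : a \notin s by rewrite memS (negPf nPa) !andbF.
  (* In the link, [c] has two neighbours: [a], which is outside [s], and another one, which is in
     [s]. *)
  have -> : odd (\sum_(v <- s) e c v) = true.
    have [y [y' [yy' yS y'S [exy exy'] [[ecy ecy'] h]]]] := deg c cs.
    rewrite (two c y y' h yy').
    have [ya|ya] := eqVneq y a.
      by rewrite ya (negPf nas) (nb c y') // -ya eq_sym.
    have [y'a|y'a] := eqVneq y' a.
      by rewrite y'a (negPf nas) (nb c y).
    exfalso.
    have [p [q [pq _ hh]]] := edge_link hS xS cS exc.
    have := hh a; have := hh y; have := hh y'.
    rewrite aS exa yS y'S exy exy' ecy ecy' (exs _ _ eac) /=.
    move=> /esym/orP[]/eqP ? /esym/orP[]/eqP ? /esym/orP[]/eqP ?; subst;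
      by rewrite ?eqxx in yy' ya y'a.
  (* Every other vertex of [s] has degree 2 in [s], since only [b] and [c] are adjacent to [a] in
     the link. *)
  rewrite addTb big_seq_cond.
  rewrite [X in odd X](eq_bigr (fun=> 2%N)) ?big_const_seq ?iter_addn_0 ?oddM //.
  move=> w /andP[ws wc].
  have [y [y' [yy' yS y'S [exy exy'] [[ewy ewy'] h]]]] := deg w ws.
  have wE : w \in S /\ e x w by move: ws; rewrite memS => /and3P[].
  have nwa v : e w v -> v != a.
    move=> ewv; apply/eqP => va; rewrite va e_sym in ewv.
    case: (hxa w wE.1 wE.2 ewv) => wE'; last by rewrite wE' eqxx in wc.
    by move: ws; rewrite memS wE' (negPf nPb) !andbF.
  by rewrite (two w y y' h yy') (nb w y) ?nwa // (nb w y') ?nwa.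
have [_ _ /(_ x xS)[_ con _]] := hS.
(* Now [P] holds at the outer neighbours [c] of [a] and [z] of [b], so [a], [b] and the vertices in
   [P] form a set closed under adjacency in the link. *)
suff h w : w \in nbhd S x -> [|| w == a, w == b | P w].
  move=> w wS exw wa wb; have := h w.
  by rewrite in_nbhd wS exw (negPf wa) (negPf wb) => /(_ isT).
apply: (con (fun w => [|| w == a, w == b | P w])).
  by exists a; rewrite ?in_nbhd ?aS ?eqxx.
move=> u v; rewrite !in_nbhd => /andP[uS exu] /andP[vS exv] hu euv.
have [//|va] := eqVneq v a; have [//|vb /=] := eqVneq v b.
case/or3P: hu => [/eqP ua|/eqP ub|Pu]; last exact: (stepP u v).
  rewrite ua in euv; case: (hxa v vS exv euv) => vE; last by rewrite vE.
  by rewrite vE eqxx in vb.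
rewrite ub in euv; case: (hxb v vS exv euv) => vE; last by rewrite vE.
by rewrite vE eqxx in va.
Qed.

End Graphs.

(** * Points of the plane: signed areas and crossing segments *)

Section Plane.
Variables (R : realFieldType) (T : choiceType) (X Y : T -> R).
Implicit Types (s : R) (a b c d p q u v w x y : T).

(** Squaring avoids square roots, so the geometry works over any real field. *)
Definition sqdist u v : R := (X u - X v) ^+ 2 + (Y u - Y v) ^+ 2.

Definition near : rel T := [rel u v | (u != v) && (sqdist u v < 1)].

(* Twice the signed area of the triangle abc, scaled by s. Replacing s by - s
   reflects the plane, so every lemma also provides its mirror image. *)
Definition area s a b c : R :=
  s * ((X b - X a) * (Y c - Y a) - (Y b - Y a) * (X c - X a)).

Lemma sqdistC u v : sqdist u v = sqdist v u.
Proof. by rewrite /sqdist; ring. Qed.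

Lemma nearE u v : near u v = (u != v) && (sqdist u v < 1).
Proof. by []. Qed.

Lemma near_sym : symmetric near.
Proof. by move=> u v; rewrite !nearE eq_sym sqdistC. Qed.

Lemma near_irr : irreflexive near.
Proof. by move=> u; rewrite nearE eqxx. Qed.

Lemma areaR s a b c : area s b c a = area s a b c.
Proof. by rewrite /area; ring. Qed.

Lemma areaC s a b c : area s b a c = - area s a b c.
Proof. by rewrite /area; ring. Qed.

Lemma areaN s a b c : area (- s) a b c = - area s a b c.
Proof. by rewrite /area; ring. Qed.

Lemma area_split s a b c p :
  area s a b c = area s a b p + area s b c p + area s c a p.
Proof. by rewrite /area; ring. Qed.

(** The three-term Grassmann-Plücker relation for the vectors from [x]; it deduces the sign of one
    area from the signs of others. *)
Lemma area_plucker s x a b c d :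
  area s x a b * area s x c d - area s x a c * area s x b d
    + area s x a d * area s x b c = 0.
Proof. by rewrite /area; ring. Qed.

(** The open unit ball is convex and contains the origin. The common denominator [D] is cleared so
    that the weights can be areas. *)
Lemma ball_convex (k l D x1 x2 u1 u2 w1 w2 : R) :
  0 <= k -> 0 <= l -> 0 < D -> k + l <= D ->
  D * x1 = k * u1 + l * w1 -> D * x2 = k * u2 + l * w2 ->
  u1 ^+ 2 + u2 ^+ 2 < 1 -> w1 ^+ 2 + w2 ^+ 2 < 1 -> x1 ^+ 2 + x2 ^+ 2 < 1.
Proof.
move=> k0 l0 D0 klD e1 e2 u1' w1'.
pose M := Num.max (u1 ^+ 2 + u2 ^+ 2) (w1 ^+ 2 + w2 ^+ 2).
have M1 : M < 1 by rewrite gt_max u1'.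
have uM : u1 ^+ 2 + u2 ^+ 2 <= M by rewrite le_max lexx.
have wM : w1 ^+ 2 + w2 ^+ 2 <= M by rewrite le_max lexx orbT.
have M0 : 0 <= M by apply: le_trans uM; rewrite addr_ge0 ?sqr_ge0.
have e : D ^+ 2 * (x1 ^+ 2 + x2 ^+ 2) =
    (k + l) * (k * (u1 ^+ 2 + u2 ^+ 2) + l * (w1 ^+ 2 + w2 ^+ 2))
    - k * l * ((u1 - w1) ^+ 2 + (u2 - w2) ^+ 2).
  rewrite mulrDr -!exprMn e1 e2; ring.
have kl : 0 <= k * l * ((u1 - w1) ^+ 2 + (u2 - w2) ^+ 2).
  by rewrite !mulr_ge0 // addr_ge0 ?sqr_ge0.
have D2 : 0 < D ^+ 2 by rewrite exprn_gt0.
rewrite -(ltr_pM2l D2) e mulr1.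
have h1 : k * (u1 ^+ 2 + u2 ^+ 2) <= k * M by rewrite ler_wpM2l.
have h2 : l * (w1 ^+ 2 + w2 ^+ 2) <= l * M by rewrite ler_wpM2l.
have h3 : (k + l) * (k * (u1 ^+ 2 + u2 ^+ 2) + l * (w1 ^+ 2 + w2 ^+ 2)) <=
    (k + l) * ((k + l) * M).
  by rewrite ler_wpM2l ?addr_ge0 // mulrDl lerD.
have h4 : (k + l) * (k + l) * M <= D * D * M.
  by rewrite ler_wpM2r // ler_pM ?addr_ge0.
have h5 : D * D * M < D ^+ 2 by rewrite -expr2 gtr_pMr.
rewrite -mulrA in h4; lra.
Qed.

(** If the crossing point has parameters t on [a b] and r on [c d], then a - c = t(a - b) + r(d - c)
    and b - d = (1 - t)(b - a) + (1 - r)(c - d). One of the weight sums t + r and 2 - t - r is at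
    most 1. *)
Lemma crossing s a b c d : near a b -> near c d ->
  0 <= area s a b c -> area s a b d <= 0 ->
  area s c d a <= 0 -> 0 <= area s c d b -> area s a b d < area s a b c ->
  sqdist a c < 1 \/ sqdist b d < 1.
Proof.
move=> /andP[_ ab] /andP[_ cd] abc abd cda cdb lt.
pose D := area s a b c - area s a b d.
have D0 : 0 < D by rewrite subr_gt0.
have DE : D = area s c d b - area s c d a by rewrite /D /area; ring.
have [le|gt] := lerP (area s a b c - area s c d a) D; [left|right].
- apply: (@ball_convex (- area s c d a) (area s a b c) D _ _
    (X a - X b) (Y a - Y b) (X d - X c) (Y d - Y c)); rewrite ?oppr_ge0 //.
  + lra.
  + by rewrite /D /area; ring.
  + by rewrite /D /area; ring.
  + by rewrite -[X in X < _]/(sqdist d c) sqdistC.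
- apply: (@ball_convex (area s c d b) (- area s a b d) D _ _
    (X b - X a) (Y b - Y a) (X c - X d) (Y c - Y d)); rewrite ?oppr_ge0 //.
  + rewrite /D in DE gt *; lra.
  + by rewrite /D /area; ring.
  + by rewrite /D /area; ring.
  + by rewrite -[X in X < _]/(sqdist b a) sqdistC.
Qed.

(** Apply [crossing] twice, the second time with [a] and [b] exchanged and the plane reflected. In
    every case some endpoint of one edge is adjacent to both endpoints of the other. *)
Lemma crossing_edges s a b c d : near a b -> near c d ->
  [&& a != c, a != d, b != c & b != d] ->
  0 <= area s a b c -> area s a b d <= 0 ->
  area s c d a <= 0 -> 0 <= area s c d b -> area s a b d < area s a b c ->
  (near a c || near b d) && (near a d || near b c).
Proof.
move=> ab cd /and4P[ac ad bc bd] abc abd cda cdb lt; rewrite !nearE ac ad bc bd /=.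
apply/andP; split; apply/orP; first exact: (crossing ab cd abc).
have ba : near b a by rewrite near_sym.
by case: (@crossing (- s) _ _ _ _ ba cd);
  rewrite ?areaN ?[area _ b a _]areaC ?opprK ?oppr_ge0 ?oppr_le0 //; tauto.
Qed.

(** * Surfaces in the plane: empty triangles and links confined to an angle *)

Section Surface.
Variable S : {fset T}.
Hypothesis hS : locally_sphere near 2 S.

Let K4 a b c p := @no_K4 T near near_sym near_irr S a b c p hS.

(** The apex [q] of the second triangle on [a b] is close to [a] and [b], hence by convexity to [c],
    whereas the two apexes of an edge are not adjacent. *)
Lemma no_vertex_on_edge (t : R) a b c : a \in S -> b \in S -> c \in S ->
  near a b -> near a c -> near b c -> 0 <= t <= 1 ->
  X c - X a = t * (X b - X a) -> Y c - Y a = t * (Y b - Y a) -> False.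
Proof.
move=> aS bS cS ab ac bc /andP[t0 t1] ex ey.
have [q [[qS aq bq qc ncq] _]] := other_neighbour near_sym hS aS bS cS ab ac bc.
have /negP[] := ncq; rewrite nearE eq_sym qc /=.
apply: (@ball_convex (1 - t) t 1 _ _ (X a - X q) (Y a - Y q) (X b - X q) (Y b - Y q)).
- by rewrite subr_ge0.
- by [].
- by [].
- lra.
- lra.
- lra.
- by case/andP: aq.
- by case/andP: bq.
Qed.

(** Of three collinear points one lies between the other two, which [no_vertex_on_edge] excludes. *)
Lemma triangle_nondegenerate s a b c : s != 0 -> a \in S -> b \in S -> c \in S ->
  near a b -> near a c -> near b c -> area s a b c != 0.
Proof.
move=> s0 aS bS cS ab ac bc; rewrite /area mulf_eq0 negb_or s0 /=.
apply/eqP; set u1 := X b - X a; set u2 := Y b - Y a.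
set w1 := X c - X a; set w2 := Y c - Y a => col.
pose U := u1 ^+ 2 + u2 ^+ 2.
have U0 : 0 <= U by rewrite addr_ge0 ?sqr_ge0.
(* Distinct elements of [T] may have equal coordinates; then [b] is the point with parameter 0 on
   the edge [a c]. *)
have [U00|Un0] := eqVneq U 0.
  have /andP[/eqP u10 /eqP u20] : (u1 == 0) && (u2 == 0).
    by move: U00 => /eqP; rewrite paddr_eq0 ?sqr_ge0 // !sqrf_eq0.
  apply: (@no_vertex_on_edge 0 a c b) => //; first by rewrite near_sym.
  - by rewrite lexx ler01.
  - by rewrite mul0r.
  - by rewrite mul0r.
(* The parameter of [c] on the line [a b]; its position relative to 0 and 1 tells which vertex is in
   the middle. *)
pose t := (u1 * w1 + u2 * w2) / U.
have e1 : w1 = t * u1.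
  apply: (mulfI Un0).
  rewrite [RHS](_ : _ = (u1 * w1 + u2 * w2) * u1); last by rewrite /t; field.
  have -> : U * w1 = (u1 * w1 + u2 * w2) * u1 - u2 * (u1 * w2 - u2 * w1).
    by rewrite /U; ring.
  by rewrite col; ring.
have e2 : w2 = t * u2.
  apply: (mulfI Un0).
  rewrite [RHS](_ : _ = (u1 * w1 + u2 * w2) * u2); last by rewrite /t; field.
  have -> : U * w2 = (u1 * w1 + u2 * w2) * u2 + u1 * (u1 * w2 - u2 * w1).
    by rewrite /U; ring.
  by rewrite col; ring.
have [t0|t0] := ltrP t 0.
  have t1 : 0 < 1 - t by lra.
  apply: (@no_vertex_on_edge (1 - t)^-1 b c a) => //; rewrite 1?near_sym //.
  - by rewrite invr_ge0 ltW //= invf_le1 //; lra.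
  - apply: (mulfI (lt0r_neq0 t1)); rewrite mulVKf ?lt0r_neq0 //.
    rewrite /u1 /w1 in e1; lra.
  - apply: (mulfI (lt0r_neq0 t1)); rewrite mulVKf ?lt0r_neq0 //.
    rewrite /u2 /w2 in e2; lra.
have [t1|t1] := lerP t 1.
  by apply: (@no_vertex_on_edge t a b c) => //; rewrite t0.
have tp : 0 < t by lra.
apply: (@no_vertex_on_edge t^-1 a c b) => //; rewrite 1?near_sym //.
- by rewrite invr_ge0 t0 /= invf_le1 // ltW.
- by rewrite -/w1 e1 mulKf ?lt0r_neq0.
- by rewrite -/w2 e2 mulKf ?lt0r_neq0.
Qed.

(** The areas are barycentric coordinates of [p]. By convexity [p] is then adjacent to all three
    vertices, giving a K4. *)
Lemma triangle_empty s a b c p : s != 0 ->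
  a \in S -> b \in S -> c \in S -> p \in S ->
  near a b -> near a c -> near b c ->
  0 <= area s a b p -> 0 <= area s b c p -> 0 <= area s c a p ->
  [|| p == a, p == b | p == c].
Proof.
move=> s0 aS bS cS pS ab ac bc abp bcp cap; apply: contraT.
rewrite !negb_or => /and3P[pa pb pc]; exfalso.
have D0 : 0 < area s a b c.
  rewrite lt0r triangle_nondegenerate // (area_split s a b c p).
  by rewrite !addr_ge0.
have DE := area_split s a b c p.
have [_ ab1] := andP ab; have [_ ac1] := andP ac; have [_ bc1] := andP bc.
apply: (K4 aS bS cS pS ab ac bc); rewrite near_sym nearE ?pa ?pb ?pc /=.
- apply: (@ball_convex (area s c a p) (area s a b p) (area s a b c) _ _
    (X b - X a) (Y b - Y a) (X c - X a) (Y c - Y a)) => //; first lra;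
    by [rewrite /area; ring | rewrite -[X in X < _]/(sqdist _ _) sqdistC].
- apply: (@ball_convex (area s b c p) (area s a b p) (area s a b c) _ _
    (X a - X b) (Y a - Y b) (X c - X b) (Y c - Y b)) => //; first lra;
    by [rewrite /area; ring | rewrite -[X in X < _]/(sqdist _ _) sqdistC].
- apply: (@ball_convex (area s b c p) (area s c a p) (area s a b c) _ _
    (X a - X c) (Y a - Y c) (X b - X c) (Y b - Y c)) => //; first lra;
    by [rewrite /area; ring].
Qed.

Lemma area_gt0 s a b c : 0 < area s a b c -> [&& s != 0, a != b, b != c & a != c].
Proof.
move=> h; apply/and4P; split; apply: contraTneq h => ->;
  by rewrite /area ?mul0r -leNgt le_eqVlt; apply/orP; left; apply/eqP; ring.
Qed.

Lemma outside_face s a b c p : s != 0 ->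
  a \in S -> b \in S -> c \in S -> p \in S ->
  near a b -> near a c -> near b c -> [&& p != a, p != b & p != c] ->
  0 <= area s a b p -> 0 <= area s b c p -> area s c a p < 0.
Proof.
move=> s0 aS bS cS pS ab ac bc /and3P[pa pb pc] abp bcp.
rewrite ltNge; apply/negP => cap.
have := triangle_empty s0 aS bS cS pS ab ac bc abp bcp cap.
by rewrite (negPf pa) (negPf pb) (negPf pc).
Qed.

(** If two edges of the link of [x] cross, some endpoint of one is adjacent to both endpoints of the
    other, and these three form a K4 with [x]. *)
Lemma link_crossing s x a b w w' :
  x \in S -> a \in S -> b \in S -> w \in S -> w' \in S ->
  near x a -> near x b -> near a b -> near x w -> near x w' -> near w w' ->
  w != a -> w != b ->
  0 < area s a b w -> area s a b w' < 0 ->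
  area s w w' a < 0 -> 0 < area s w w' b -> False.
Proof.
move=> xS aS bS wS w'S xa xb ab xw xw' ww' wa wb h1 h2 h3 h4.
have lt : area s a b w' < area s a b w by exact: lt_trans h1.
have w'a : a != w' by apply: contraTneq h3 => ->; rewrite /area -leNgt; lra.
have w'b : b != w' by apply: contraTneq h4 => ->; rewrite /area -leNgt; lra.
have neq : [&& a != w, a != w', b != w & b != w'].
  by rewrite w'a w'b !(eq_sym _ w) wa wb.
have := crossing_edges ab ww' neq (ltW h1) (ltW h2) (ltW h3) (ltW h4) lt.
have ba : near b a by rewrite near_sym.
have w'w : near w' w by rewrite near_sym.
case/andP=> /orP[aw|bw'] /orP[aw'|bw].
- exact: (K4 xS aS wS w'S).
- exact: (K4 xS aS bS wS).
- exact: (K4 xS aS bS w'S).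
- exact: (K4 xS bS wS w'S).
Qed.

(** Here the link edge from [w'] leaves the angle [a x b] across the ray [x a]. The triangle [x a b]
    does not contain [w'] and the triangle [x w w'] does not contain [a], so each of these points
    lies beyond the edge opposite [x]; hence [w w'] crosses [a b]. *)
Lemma cone_step_half s x a b w w' :
  x \in S -> a \in S -> b \in S -> w \in S -> w' \in S ->
  near x a -> near x b -> near a b -> near x w -> near x w' -> near w w' ->
  w != a -> w != b -> 0 < area s x a b ->
  0 < area s x a w' -> 0 < area s x w' b ->
  area s x a w <= 0 -> 0 < area s x w w' -> False.
Proof.
move=> xS aS bS wS w'S xa xb ab xw xw' ww' wa wb xab xaw' xw'b xaw xww'.
have /and4P[s0 _ _ _] := area_gt0 xab.
have /and4P[_ _ aw' xw'n] := area_gt0 xaw'; have /and4P[_ _ w'b _] := area_gt0 xw'b.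
have abw' : area s a b w' < 0.
  apply: (outside_face s0 bS xS aS) => //; rewrite 1?near_sym //.
  - by rewrite w'b !(eq_sym w') xw'n aw'.
  - by rewrite -areaR ltW.
  - exact: ltW.
have ww'a : area s w w' a < 0.
  apply: (outside_face s0 w'S xS wS) => //; rewrite 1?near_sym //.
  - by rewrite aw' eq_sym (edge_neq near_irr xa) eq_sym wa.
  - by rewrite -areaR ltW.
  - by rewrite areaC oppr_ge0 -areaR.
have abw : 0 < area s a b w.
  have := area_plucker s a b w x w'.
  have -> : area s a x w' = - area s x a w' by rewrite areaC.
  have -> : area s a b x = area s x a b by rewrite areaR.
  have -> : area s a w w' = area s w w' a by rewrite -areaR.
  have -> : area s a w x = area s x a w by rewrite areaR.
  nra.
apply: (@link_crossing s x a b w w') => //.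
have := area_plucker s w' w b x a.
have -> : area s w' w b = - area s w w' b by rewrite areaC.
have -> : area s w' x a = area s x a w' by rewrite -areaR.
have -> : area s w' w x = - area s x w w' by rewrite areaR areaC -areaR.
have -> : area s w' b a = - area s a b w' by rewrite -areaR areaC.
have -> : area s w' w a = - area s w w' a by rewrite areaC.
have -> : area s w' b x = area s x w' b by rewrite areaR.
nra.
Qed.

Lemma cone_step s x a b w w' :
  x \in S -> a \in S -> b \in S -> w \in S -> w' \in S ->
  near x a -> near x b -> near a b -> near x w -> near x w' -> near w w' ->
  w != a -> w != b -> 0 < area s x a b ->
  0 < area s x a w' -> 0 < area s x w' b ->
  0 < area s x a w /\ 0 < area s x w b.
Proof.
move=> xS aS bS wS w'S xa xb ab xw xw' ww' wa wb xab xaw' xw'b.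
have /and4P[s0 _ _ _] := area_gt0 xab.
have swap c d : area s x c d = - area s x d c by rewrite -areaR areaC areaR.
have half := cone_step_half xS aS bS wS w'S xa xb ab xw xw' ww' wa wb xab xaw' xw'b.
have ba : near b a by rewrite near_sym.
(* Exit across the ray [x b]: the same lemma with [a] and [b] exchanged and the plane reflected. *)
have mirror : area s x w b <= 0 -> area s x w w' < 0 -> False.
  move=> h1 h2; apply: (@cone_step_half (- s) x b a w w') => //; rewrite areaN;
    rewrite ?oppr_gt0 ?oppr_le0.
  - by rewrite swap oppr_lt0.
  - by rewrite swap oppr_lt0.
  - by rewrite swap oppr_lt0.
  - by rewrite swap oppr_ge0.
  - by [].
(* If [w] violates one inequality while the orientation of [x w w'] fits the other half, this
   relation shows that [w] violates the other inequality too. *)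
have P := area_plucker s x a b w w'.
have nz : area s x w w' != 0 by apply: triangle_nondegenerate.
rewrite !ltNge; split; apply/negP => h.
  have [xww'|xww'] := ltrP 0 (area s x w w'); first exact: half.
  have {}xww' : area s x w w' < 0 by rewrite lt_neqAle nz.
  apply: mirror => //.
  have E : area s x b w' = - area s x w' b by rewrite swap.
  have E2 := swap w b; rewrite E in P; nra.
have [xww'|xww'] := ltrP (area s x w w') 0; first exact: mirror.
have {}xww' : 0 < area s x w w' by rewrite lt_neqAle eq_sym nz.
apply: half => //.
have E : area s x b w' = - area s x w' b by rewrite swap.
have E2 := swap w b; rewrite E in P; nra.
Qed.

(** The link cycle enters the open angle [a x b] at [c], cannot leave it by [cone_step], and is
    followed up to [b] by [link_arc]. *)
Lemma link_in_cone s x a b c :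
  x \in S -> a \in S -> b \in S -> c \in S ->
  near x a -> near x b -> near a b -> near x c -> near a c ->
  0 < area s x a b -> 0 < area s x a c -> 0 < area s x c b ->
  forall w, w \in S -> near x w -> w != a -> w != b ->
  0 < area s x a w /\ 0 < area s x w b.
Proof.
move=> xS aS bS cS xa xb ab xc ac xab xac xcb w wS xw wa wb.
apply/andP; pose P w := (0 < area s x a w) && (0 < area s x w b).
apply: (@link_arc _ near near_sym near_irr S x a b P) => //.
- by rewrite /P [area s x a a](_ : _ = 0) ?ltxx // /area; ring.
- by rewrite /P [area s x b b](_ : _ = 0) ?ltxx ?andbF // /area; ring.
- move=> u v uS vS xu xv uv /andP[h1 h2] va vb; apply/andP.
  by apply: (@cone_step s x a b v u) => //; rewrite near_sym.
- by exists c; split=> //; apply/andP.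
Qed.

(** * Creases and the links of their endpoints *)

Ltac by_area := solve [unfold area in *; lra].

(* p1 p2 is a crease: its two common neighbours p0 and p3 lie on the same side
   of it, the cyclic order p0 p1 p2 p3 being convex. *)
Definition crease s p0 p1 p2 p3 : Prop :=
  [/\ [/\ p0 \in S, p1 \in S, p2 \in S & p3 \in S],
      [/\ near p0 p1, near p1 p2, near p2 p3, near p0 p2 & near p1 p3] &
      [/\ 0 < area s p0 p1 p2, 0 < area s p1 p2 p3,
          0 < area s p2 p3 p0 & 0 < area s p3 p0 p1]].

Lemma area_rev s a b c : area (- s) c b a = area s a b c.
Proof. by rewrite /area; ring. Qed.

Lemma crease_rev s p0 p1 p2 p3 :
  crease s p0 p1 p2 p3 -> crease (- s) p3 p2 p1 p0.
Proof.
move=> [[S0 S1 S2 S3] [n01 n12 n23 n02 n13] [a012 a123 a230 a301]].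
by split; split=> //; rewrite ?area_rev // near_sym.
Qed.

Lemma crease_ends_nonadjacent s p0 p1 p2 p3 : crease s p0 p1 p2 p3 -> ~~ near p0 p3.
Proof.
move=> [[S0 S1 S2 S3] [n01 n12 n23 n02 n13] _]; apply/negP => n03.
exact: (K4 S0 S1 S2 S3).
Qed.

Lemma crease_cone s p0 p1 p2 p3 : crease s p0 p1 p2 p3 ->
  forall w, w \in S -> near p1 w -> w != p2 -> w != p0 ->
  0 < area s p1 p2 w /\ 0 < area s p1 w p0.
Proof.
move=> [[S0 S1 S2 S3] [n01 n12 n23 n02 n13] [a012 a123 a230 a301]].
apply: (@link_in_cone s p1 p2 p0 p3); rewrite // 1?near_sym //.
- by by_area.
- by by_area.
Qed.

(** Take for [m] the second apex on [p0 p1]. The angle at [p1] contains [m], and emptiness of the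
    triangle [p0 p1 p2] puts [m] beyond [p2 p0], so [m p0 p1 p2] is convex. *)
Lemma crease_extend s p0 p1 p2 p3 : crease s p0 p1 p2 p3 ->
  exists m, crease s m p0 p1 p2.
Proof.
move=> cr; have cone := crease_cone cr.
case: cr => -[S0 S1 S2 S3] [n01 n12 n23 n02 n13] [a012 a123 a230 a301].
have [m [[mS n0m n1m m2 _] _]] :=
  other_neighbour near_sym hS S0 S1 S2 n01 n02 n12.
have m0 : m != p0 by rewrite eq_sym (edge_neq near_irr n0m).
have m1 : m != p1 by rewrite eq_sym (edge_neq near_irr n1m).
have [h1 h2] := cone m mS n1m m2 m0.
have /and4P[s0 _ _ _] := area_gt0 a012.
have a20m : area s p2 p0 m < 0.
  apply: (outside_face s0 S0 S1 S2) => //; first by rewrite m0 m1.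
    by by_area.
  exact: ltW.
by exists m; split; split=> //; first [by_area | by rewrite near_sym].
Qed.

(** The segment [p1 v] enters the triangle [p0 p2 y] through [p0 p2], and the sign of
    [area s p1 v y] makes it leave through [p0 y]. Of the adjacencies forced by this crossing,
    [p1 y] is ruled out and [v p0] remains. *)
Lemma crease_exit_half s p0 p1 p2 y v :
  p0 \in S -> p1 \in S -> p2 \in S -> y \in S -> v \in S ->
  near p0 p1 -> near p1 p2 -> near p0 p2 -> near y p0 -> near y p2 -> near p1 v ->
  ~~ near p1 y -> [&& v != p0, v != p2, v != y & p1 != y] ->
  0 < area s p0 p1 y -> 0 < area s p1 p2 y -> area s p2 p0 y < 0 ->
  0 < area s p1 v p0 -> area s p2 p0 v < 0 ->
  area s p1 v y <= 0 -> near v p0.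
Proof.
move=> S0 S1 S2 Sy Sv n01 n12 n02 ny0 ny2 n1v n1y /and4P[v0 v2 vy y1].
move=> a01y a12y a20y a1v0 a20v a1vy.
have /and4P[s0 p01 _ _] := area_gt0 a01y.
(* Otherwise emptiness of the triangle [y p0 p2] puts [v] beyond [p2 y], on the wrong side of the
   ray from [p1] through [y]. *)
have ny0v : area s y p0 v < 0.
  rewrite ltNge; apply/negP => a0yv.
  have a2yv : area s p2 y v < 0.
    apply: (outside_face s0 Sy S0 S2) => //; first by rewrite vy v0.
    by by_area.
  have := area_plucker s y p0 p2 p1 v.
  have -> : area s y p0 p2 = - area s p2 p0 y by rewrite /area; ring.
  have -> : area s y p1 v = area s p1 v y by rewrite /area; ring.
  have -> : area s y p0 p1 = area s p0 p1 y by rewrite /area; ring.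
  have -> : area s y p2 v = - area s p2 y v by rewrite /area; ring.
  have -> : area s y p2 p1 = - area s p1 p2 y by rewrite /area; ring.
  nra.
have n0y : near p0 y by rewrite near_sym.
have neq : [&& p1 != p0, p1 != y, v != p0 & v != y] by rewrite eq_sym p01 y1 v0.
have lt : area s p1 v y < area s p1 v p0 by apply: le_lt_trans a1v0.
have a0y1 : area s p0 y p1 <= 0.
  by by_area.
have a0yv : 0 <= area s p0 y v by by_area.
have /andP[_] := crossing_edges n1v n0y neq (ltW a1v0) a1vy a0y1 a0yv lt.
by rewrite (negPf n1y).
Qed.

Lemma crease_link s m p0 p1 p2 p3 :
  crease s m p0 p1 p2 -> crease s p0 p1 p2 p3 ->
  forall v, v \in S -> near p1 v -> [|| v == p0, v == p2, v == m | v == p3].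
Proof.
move=> crm crp v vS n1v; apply: contraT; rewrite !negb_or => /and4P[v0 v2 vm v3].
exfalso.
have cone0 := crease_cone crm; have cone1 := crease_cone crp.
have cone2 := crease_cone (crease_rev crp).
have nm2 := crease_ends_nonadjacent crm; have n03 := crease_ends_nonadjacent crp.
case: crm => -[Sm S0 S1 S2] [nm0 n01 n12 nm1 n02] [am01 a012 a12m a2m0].
case: crp => -[_ _ _ S3] [_ _ n23 _ n13] [_ a123 a230 a301].
have n10 : near p1 p0 by rewrite near_sym.
have n21 : near p2 p1 by rewrite near_sym.
have n20 : near p2 p0 by rewrite near_sym.
have /and4P[s0 _ _ _] := area_gt0 a012.
(* The second apex on [p0 p2]. The creases [p0 p1] and [p1 p2] confine the links of [p0] and [p2],
   which places [y] inside the angle [p0 p1 p2]. *)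
have [y [[Sy n0y n2y y1 n1y] _]] :=
  other_neighbour near_sym hS S0 S2 S1 n02 n01 n21.
have ym : y != m by apply: contraNneq n1y => ->; rewrite near_sym.
have y3 : y != p3 by apply: contraNneq n1y => ->.
have [a01y _] := cone0 y Sy n0y y1 ym.
have [a12y _] := cone2 y Sy n2y y1 y3.
have {}a12y : 0 < area s p1 p2 y by rewrite areaN areaC opprK in a12y.
have [a12v a1v0] := cone1 v vS n1v v2 v0.
have y0 : y != p0 by rewrite eq_sym (edge_neq near_irr n0y).
have y2 : y != p2 by rewrite eq_sym (edge_neq near_irr n2y).
have v1 : v != p1 by rewrite eq_sym (edge_neq near_irr n1v).
have vy : v != y by apply: contraNneq n1y => <-.
have a20y : area s p2 p0 y < 0.
  by apply: (outside_face s0 S0 S1 S2) => //; rewrite ?y0 ?y1 ?y2 ?ltW.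
have a20v : area s p2 p0 v < 0.
  apply: (outside_face s0 S0 S1 S2) => //; rewrite ?v0 ?v1 ?v2 ?ltW //.
  by by_area.
have m2 : m != p2 by have /and4P[_ _ + _] := area_gt0 a12m; rewrite eq_sym.
have p30 : p3 != p0 by have /and4P[] := area_gt0 a301.
have n0m : near p0 m by rewrite near_sym.
have n1m : near p1 m by rewrite near_sym.
(* The two apexes on [p0 p1] are [m] and [p2], those on [p1 p2] are [p0] and [p3]; [v] is none of
   them. *)
have v_p0 : near v p0 -> False.
  move=> nv0; have n0v : near p0 v by rewrite near_sym.
  have := common_neighbours hS S0 S1 n01 m2 Sm n0m n1m S2 n02 n12 vS n0v n1v.
  by move=> -[] vE; [rewrite vE eqxx in vm | rewrite vE eqxx in v2].
have v_p2 : near v p2 -> False.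
  move=> nv2; have n2v : near p2 v by rewrite near_sym.
  have := common_neighbours hS S1 S2 n12 p30 S3 n13 n23 S0 n10 n20 vS n1v n2v.
  by move=> -[] vE; [rewrite vE eqxx in v3 | rewrite vE eqxx in v0].
(* The side of the ray [p1 v] on which [y] lies decides whether the segment crosses [p0 y] or
   [p2 y]; the second case is the mirror image. *)
case: (lerP (area s p1 v y) 0) => [a1vy|/ltW a1vy].
  apply: v_p0; apply: (@crease_exit_half s p0 p1 p2 y v) => //;
    try by rewrite near_sym.
  by rewrite v0 v2 vy eq_sym.
apply: v_p2; apply: (@crease_exit_half (- s) p2 p1 p0 y v) => //;
  try (by rewrite near_sym); rewrite ?areaN ?oppr_gt0 ?oppr_lt0 ?oppr_le0 //;
  try by by_area.
by rewrite v0 v2 vy eq_sym.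
Qed.

Definition folded v := exists s p0 p2 p3, crease s p0 v p2 p3.

Lemma folded_link p1 : folded p1 ->
  [/\ cocktail_party near (nbhd near S p1), #|` nbhd near S p1| = 4%N &
      forall v, v \in nbhd near S p1 -> folded v].
Proof.
move=> [s [p0 [p2 [p3 crp]]]]; have [m crm] := crease_extend crp.
have nbr := crease_link crm crp.
have nm2 := crease_ends_nonadjacent crm; have n03 := crease_ends_nonadjacent crp.
have fold0 : folded p0 by exists s, m, p1, p2.
have fold2 : folded p2 by exists (- s), p3, p1, p0; apply: crease_rev.
have foldm : folded m.
  by have [m' crm'] := crease_extend crm; exists s, m', p0, p1.
have fold3 : folded p3.
  have [p4 cr4] := crease_extend (crease_rev crp).
  by exists (- s), p4, p2, p1.
case: crm => -[Sm S0 S1 S2] [nm0 n01 n12 nm1 n02] [am01 a012 a12m a2m0].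
case: crp => -[_ _ _ S3] [_ _ n23 _ n13] [_ a123 a230 a301].
have n10 : near p1 p0 by rewrite near_sym.
have n20 : near p2 p0 by rewrite near_sym.
have n32 : near p3 p2 by rewrite near_sym.
have n0m : near p0 m by rewrite near_sym.
have n1m : near p1 m by rewrite near_sym.
have n2m : ~~ near p2 m by rewrite near_sym.
have n30 : ~~ near p3 p0 by rewrite near_sym.
(* The second apex on [p1 p3] lies in the link of [p1], where only [m] is left; this closes the
   4-cycle. *)
have n3m : near p3 m.
  have [c [[cS n1c n3c c2 _] _]] :=
    other_neighbour near_sym hS S1 S3 S2 n13 n12 n32.
  case/or4P: (nbr c cS n1c) => /eqP E; subst c => //.
  - by rewrite n3c in n30.
  - by rewrite eqxx in c2.
  - by rewrite near_irr in n3c.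
have nm3 : near m p3 by rewrite near_sym.
have p30 : p3 != p0 by have /and4P[] := area_gt0 a301.
have p2m : p2 != m by have /and4P[] := area_gt0 a12m.
have link_mem v : (v \in nbhd near S p1) = [|| v == p0, v == p2, v == m | v == p3].
  rewrite in_nbhd; apply/andP/idP => [[vS n1v]|]; first exact: nbr.
  by case/or4P => /eqP->.
have linkE : nbhd near S p1 = p0 |` (p2 |` (m |` [fset p3])).
  by apply/fsetP => v; rewrite link_mem !inE.
split.
- move=> v; rewrite link_mem => /or4P[]/eqP->; [exists p3|exists m|exists p2|exists p0];
    rewrite link_mem eqxx ?orbT; split=> //; rewrite 1?eq_sym //;
    by move=> u; rewrite link_mem => /or4P[]/eqP->; rewrite ?eqxx.
- have ne := edge_neq near_irr; rewrite linkE !cardfsU1 cardfs1 !inE.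
  by rewrite !negb_or p2m (ne _ _ n02) (ne _ _ n0m) (ne _ _ n23) (ne _ _ nm3) eq_sym p30.
- by move=> v; rewrite link_mem => /or4P[]/eqP->.
Qed.

(** * Existence of a crease, octahedra, and induction on the dimension *)

Lemma crease_edge s p1 p2 b c :
  p1 \in S -> p2 \in S -> b \in S -> c \in S -> near p1 p2 ->
  near p1 b -> near p2 b -> near p1 c -> near p2 c -> b != c ->
  0 < area s p1 p2 b -> 0 < area s p1 p2 c -> folded p1.
Proof.
move=> S1 S2 Sb Sc n12 n1b n2b n1c n2c bc a12b a12c.
have /and4P[s0 _ _ _] := area_gt0 a12b.
(* Since the triangle [p1 p2 x] does not contain [y], the angular order of the two apexes at [p1]
   determines their order at [p2], and the four points are in convex position. *)
have half x y : x \in S -> y \in S -> x != y ->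
    near p1 x -> near p2 x -> near p1 y -> near p2 y ->
    0 < area s p1 p2 x -> 0 < area s p1 p2 y ->
    0 <= area s p1 y x -> 0 < area s p2 y x.
  move=> Sx Sy xy n1x n2x n1y n2y a12x a12y a1yx.
  have : area s p2 x y < 0.
    have /and4P[_ _ p2y p1y] := area_gt0 a12y.
    apply: (outside_face s0 Sx S1 S2) => //; try by rewrite near_sym.
    - by rewrite !(eq_sym y) xy p2y p1y.
    - by by_area.
    - exact: ltW.
  by by_area.
have fold x y : x \in S -> y \in S -> x != y ->
    near p1 x -> near p2 x -> near p1 y -> near p2 y ->
    0 < area s p1 p2 x -> 0 < area s p1 p2 y ->
    0 < area s p1 y x -> 0 < area s p2 y x -> folded p1.
  move=> Sx Sy xy n1x n2x n1y n2y a12x a12y a1yx a2yx.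
  exists s, x, p2, y; split; split=> //; try (by rewrite near_sym); by_area.
have cb : c != b by rewrite eq_sym.
have [h|h] := ltrP 0 (area s p1 c b).
  by apply: (fold b c) => //; apply: half => //; apply: ltW.
have [h'|h'] := ltrP 0 (area s p1 b c).
  by apply: (fold c b) => //; apply: half => //; apply: ltW.
(* Here [p1], [b] and [c] are collinear, so [half] applies in both orders and gives contradictory
   signs. *)
have h1 : 0 < area s p2 c b by apply: half => //; by_area.
have h2 : 0 < area s p2 b c by apply: half => //; by_area.
by exfalso; by_area.
Qed.

Lemma seq_argmin (f : T -> R) (r : seq T) x0 : x0 \in r ->
  exists2 x, x \in r & forall y, y \in r -> f x <= f y.
Proof.
elim: r x0 => [//|z r IH] x0 _.
case: r IH => [_|z' r IH].
  by exists z => [|y]; rewrite inE // => /eqP->.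
have [x xr hx] := IH z' (mem_head _ _).
have [le|lt] := lerP (f x) (f z).
  exists x => [|y]; first by rewrite inE xr orbT.
  by rewrite inE => /orP[/eqP->|/hx].
exists z => [|y]; first exact: mem_head.
rewrite inE => /orP[/eqP->//|/hx]; exact/le_trans/ltW.
Qed.

(* A vertex x farthest from the origin sees all the others in an open
   half-plane; its neighbour of least slope spans a crease. *)
Lemma exists_folded : exists2 v, v \in S & folded v.
Proof.
have [S0 _ _] := hS; have [x0 x0S] : exists x0, x0 \in S by apply/fset0Pn.
have [x xS xmax] := seq_argmin (fun v => - (X v ^+ 2 + Y v ^+ 2)) x0S.
have [a0 a0S xa0] := surface_has_neighbour hS xS.
have n10 : (-1 : R) != 0 by rewrite oppr_eq0 oner_eq0.
(* Up to the factor |x|, [h] and [g] are the coordinates of w - x along -x and perpendicular to it,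
   so that [g w / h w] is a slope. *)
pose h w := X x * (X x - X w) + Y x * (Y x - Y w).
pose g w := X x * (Y w - Y x) - Y x * (X w - X x).
have h0 w : w \in S -> near x w -> 0 < h w.
  move=> wS xw; have := xmax w wS; rewrite lerN2 => le.
  have [c [c' [_ _ /(_ c)]]] := edge_link hS xS wS xw.
  rewrite eqxx => /andP[/andP[cS xc] wc].
  have := triangle_nondegenerate n10 xS wS cS xw xc wc.
  apply: contraNT; rewrite -leNgt => hw.
  (* This uses |x - w|^2 = |w|^2 - |x|^2 + 2 [h w], where |w| is at most |x|. *)
  have : (X x - X w) ^+ 2 + (Y x - Y w) ^+ 2 == 0.
    rewrite eq_le addr_ge0 ?sqr_ge0 // andbT; rewrite /h in hw; nra.
  rewrite paddr_eq0 ?sqr_ge0 // !sqrf_eq0 !subr_eq0 => /andP[/eqP eX /eqP eY].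
  by rewrite /area eX eY; apply/eqP; ring.
have a0N : a0 \in nbhd near S x by rewrite in_nbhd a0S.
have [a + amin] := seq_argmin (fun w => g w / h w) a0N.
rewrite in_nbhd => /andP[aS xa].
have area_ge0 w : w \in S -> near x w -> 0 <= area (-1) x a w.
  move=> wS xw; have := amin w; rewrite in_nbhd wS xw => /(_ isT).
  have ha := h0 a aS xa; have hw := h0 w wS xw.
  rewrite ler_pdivrMr // mulrAC ler_pdivlMr // => le.
  have x2 : 0 < X x ^+ 2 + Y x ^+ 2.
    rewrite lt0r addr_ge0 ?sqr_ge0 // andbT paddr_eq0 ?sqr_ge0 // !sqrf_eq0.
    apply: contraTN ha => /andP[/eqP eX /eqP eY].
    by rewrite /h eX eY !mul0r addr0 ltxx.
  rewrite -(pmulr_rge0 _ x2).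
  have -> : (X x ^+ 2 + Y x ^+ 2) * area (-1) x a w = g w * h a - g a * h w.
    by rewrite /g /h /area; ring.
  by rewrite subr_ge0.
have [b [c [bc _ mem]]] := edge_link hS xS aS xa.
have := mem b; rewrite eqxx => /andP[/andP[bS xb] ab].
have := mem c; rewrite eqxx orbT => /andP[/andP[cS xc] ac].
exists x => //; apply: (@crease_edge (-1) x a b c) => //;
  by rewrite lt0r area_ge0 // andbT triangle_nondegenerate.
Qed.

Lemma planar_surface_octahedron : cocktail_party near S /\ #|` S| = 6%N.
Proof.
have [S0 conS _] := hS; have [x xS fx] := exists_folded.
have all_folded : forall v, v \in S -> folded v.
  apply: conS; first by exists x.
  move=> u v uS vS fu uv; have [_ _] := folded_link fu; apply.
  by rewrite in_nbhd vS.
have [cp card] : cocktail_party near S /\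
    forall v, v \in S -> #|` S| = (#|` nbhd near S v|.+2)%N.
  apply: cocktail_party_from_links; [exact: near_sym|exact: near_irr|..] => //.
  - by move=> v /all_folded/folded_link[].
  - move=> v /(surface_has_neighbour hS)[a aS va].
    by apply/fset0Pn; exists a; rewrite in_nbhd aS.
  - move=> v u vS; rewrite in_nbhd => /andP[uS vu]; apply/fset0Pn.
    have [b [b' [_ _ /(_ b)]]] := edge_link hS vS uS vu.
    rewrite eqxx => /andP[/andP[bS vb] ub].
    by exists b; rewrite !in_nbhd bS vb.
split=> //; rewrite (card x) //.
by have [_ -> _] := folded_link (all_folded x xS).
Qed.

End Surface.

(** Vertex links are spheres of one dimension less on points of the same plane; passing from a link
    to the whole graph adds one antipodal pair. *)
Lemma planar_sphere_cocktail_party (d : nat) (S : {fset T}) :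
  locally_sphere near d.+2 S ->
  cocktail_party near S /\ #|` S| = (d.+3).*2.
Proof.
elim: d S => [|d IH] S hS; first exact: planar_surface_octahedron.
have [S0 conS lk] := hS.
have [cp card] : cocktail_party near S /\
    forall v, v \in S -> #|` S| = (#|` nbhd near S v|.+2)%N.
  apply: cocktail_party_from_links; [exact: near_sym|exact: near_irr|..] => //.
  - by move=> v /lk/IH[].
  - by move=> v /lk[].
  - by move=> v u /lk[_ _ +] uN => /(_ u uN)[].
have [x xS] : exists x, x \in S by apply/fset0Pn.
by split=> //; rewrite (card x xS) (IH _ (lk x xS)).2.
Qed.

End Plane.

(** * From flag complexes to graphs and back *)

Section FlagComplexes.
Variables (T : choiceType) (e : rel T).
Hypotheses (e_sym : symmetric e) (e_irr : irreflexive e).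
Implicit Types (S A B : {fset T}) (u v w x y : T).

(** Remove an antipodal pair, label the rest by induction, and give the pair the new first
    coordinate [n]. Labels in [nat] keep the codomain fixed during the induction. *)
Lemma cocktail_party_labelling n S : cocktail_party e S -> #|` S| = n.*2 ->
  exists f : T -> nat * bool,
    [/\ forall v, v \in S -> ((f v).1 < n)%N,
        forall i b, (i < n)%N -> exists2 v, v \in S & f v = (i, b),
        forall u v, u \in S -> v \in S -> e u v = ((f u).1 != (f v).1) &
        {in S &, injective f}].
Proof.
elim: n S => [|n IH] S cpS cardS.
  have S0 v : v \in S -> False by rewrite (cardfs0_eq cardS) inE.
  by exists (fun=> (0%N, true)); split=> [v /S0|//|u v /S0|u v /S0].
have /fset0Pn[v vS] : S != fset0 by rewrite -cardfs_eq0 cardS.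
have [w [wS wv nvw vadj]] := cpS v vS.
have wadj u : u \in S -> u != v -> u != w -> e w u.
  move=> uS uv uw; have [z [zS _ _ zadj]] := cpS w wS.
  apply: (zadj) => //; apply: contraNneq nvw => uz.
  by rewrite e_sym zadj // -?uz eq_sym.
pose S' := S `\ v `\ w.
have S'E u : (u \in S') = [&& u != w, u != v & u \in S] by rewrite !inE.
have cpS' : cocktail_party e S'.
  move=> u; rewrite S'E => /and3P[uw uv uS]; have [z [zS zu nuz uadj]] := cpS u uS.
  exists z; rewrite S'E zS andbT; split=> //.
    apply/andP; split; apply: contraNneq nuz => ->; rewrite e_sym; first exact: wadj.
    exact: vadj.
  by move=> y; rewrite S'E => /and3P[_ _ yS]; apply: uadj.
have cardS' : #|` S'| = n.*2.
  have := cardfsD1 v S; have := cardfsD1 w (S `\ v).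
  rewrite -/S' vS !inE wv wS cardS doubleS /= => -> => -[].
  by lia.
have [f [f_lt f_surj f_adj f_inj]] := IH S' cpS' cardS'.
exists (fun u => if u == v then (n, true) else if u == w then (n, false) else f u).
have inS' u : u \in S -> u != v -> u != w -> u \in S'.
  by move=> uS uv uw; rewrite S'E uv uw.
have ltn_f u : u \in S -> u != v -> u != w -> (f u).1 == n = false.
  by move=> uS uv uw; rewrite ltn_eqF // f_lt // inS'.
split.
- move=> u uS; have [//|uv] := eqVneq u v; have [//|uw] := eqVneq u w.
  by rewrite ltnW // ltnS f_lt // inS'.
- move=> i b; rewrite ltnS leq_eqVlt => /orP[/eqP->|/f_surj-/(_ b)[u]].
    case: b; first by exists v; rewrite ?eqxx.
    by exists w; rewrite // (negPf wv) eqxx.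
  by rewrite S'E => /and3P[uw uv uS] fu; exists u; rewrite // (negPf uv) (negPf uw).
- move=> x y xS yS; have [->|xv] := eqVneq x v.
    have [->|yv] := eqVneq y v; first by rewrite e_irr eqxx.
    have [->|yw] := eqVneq y w; first by rewrite (negPf nvw) eqxx.
    by rewrite vadj // eq_sym /= ltn_f.
  have [->|xw] := eqVneq x w.
    have [->|yv] := eqVneq y v; first by rewrite e_sym (negPf nvw) eqxx.
    have [->|yw] := eqVneq y w; first by rewrite e_irr eqxx.
    by rewrite wadj // eq_sym /= ltn_f.
  have [->|yv] := eqVneq y v; first by rewrite e_sym vadj //= ltn_f.
  have [->|yw] := eqVneq y w; first by rewrite e_sym wadj //= ltn_f.
  by apply: f_adj; apply: inS'.
- move=> x y xS yS; have [->|xv] := eqVneq x v.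
    have [->|yv] := eqVneq y v; first by [].
    have [->|yw] := eqVneq y w; first by [].
    by move=> E; have := ltn_f y yS yv yw; rewrite -E eqxx.
  have [->|xw] := eqVneq x w.
    have [->|yv] := eqVneq y v; first by [].
    have [->|yw] := eqVneq y w; first by [].
    by move=> E; have := ltn_f y yS yv yw; rewrite -E eqxx.
  have [->|yv] := eqVneq y v.
    by move=> E; have := ltn_f x xS xv xw; rewrite E eqxx.
  have [->|yw] := eqVneq y w.
    by move=> E; have := ltn_f x xS xv xw; rewrite E eqxx.
  by apply: f_inj; apply: inS'.
Qed.

Definition clique A : Prop := forall u v, u \in A -> v \in A -> u != v -> e u v.

Definition clique_complex S (K : complex T) : Prop :=
  forall A, face K A <-> [/\ A != fset0, A `<=` S & clique A].

Section CliqueComplex.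
Variables (S : {fset T}) (K : complex T).
Hypothesis KS : clique_complex S K.

Lemma clique_complex_vertices v : vertices K v <-> v \in S.
Proof.
rewrite /vertices /= KS; split=> [[_ /fsubsetP/(_ v)]|vS].
  by rewrite inE eqxx => /(_ isT).
split; first by apply/fset0Pn; exists v; rewrite inE.
  by apply/fsubsetP => u; rewrite inE => /eqP->.
by move=> u w; rewrite !inE => /eqP-> /eqP->; rewrite eqxx.
Qed.

(** Two vertices are adjacent exactly when their first labels differ, so cliques correspond to label
    sets without an antipodal pair. *)
Lemma cocktail_party_isomorphic m : cocktail_party e S -> #|` S| = (m.+1).*2 ->
  isomorphic K (crosspolytope_boundary m.+1).
Proof.
move=> cpS cardS.
have [f [f_lt f_surj f_adj f_inj]] := cocktail_party_labelling cpS cardS.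
pose g v : 'I_m.+1 * bool := (inord (f v).1, (f v).2).
have g1 u v : u \in S -> v \in S -> ((g u).1 == (g v).1) = ((f u).1 == (f v).1).
  by move=> uS vS; rewrite -val_eqE /= !inordK // f_lt.
have g_inj : {in S &, injective g}.
  move=> u v uS vS guv; apply: f_inj => //.
  have := g1 u v uS vS; rewrite guv eqxx => /esym/eqP f1.
  by case: guv => _; case: (f u) (f v) f1 => [? ?] [? ?] /= -> ->.
exists g; split.
  split.
  - move=> v _; split; first by apply/fset0Pn; exists (g v); rewrite inE.
    by move=> w; rewrite !inE => /eqP->; apply/eqP => -[]; case: (f v).2.
  - move=> u v /set_mem/clique_complex_vertices uS.
    by move=> /set_mem/clique_complex_vertices vS; apply: g_inj.
  - move=> [i b] _; have [v vS fv] := f_surj i b (ltn_ord i).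
    exists v; first exact/clique_complex_vertices.
    by rewrite /g fv /= inord_val.
move=> A AV; have AS v : v \in A -> v \in S by move=> /AV/clique_complex_vertices.
rewrite KS /=; split=> [[/fset0Pn[a aA] _ clA]|[A0 anti]].
  split; first by apply/fset0Pn; exists (g a); apply: in_imfset.
  move=> _ /imfsetP[u /= uA ->]; apply/negP => /imfsetP[v /= vA guv].
  have [uv|uv] := eqVneq u v.
    by move: guv; rewrite uv => -[] /esym/eqP; case: (f v).2.
  have := clA u v uA vA uv; rewrite f_adj ?AS // -g1 ?AS // -guv /=.
  by rewrite eqxx.
split.
- apply/fset0Pn; move: A0 => /fset0Pn[_ /imfsetP[a /= aA _]]; by exists a.
- exact/fsubsetP.
- move=> u v uA vA uv; rewrite f_adj ?AS // -g1 ?AS //.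
  apply/negP => /eqP guv.
  have guA : g u \in (g @` A)%fset by apply: in_imfset.
  have /negP[] := anti _ guA.
  suff -> : antipode (g u) = g v by apply: in_imfset.
  rewrite /antipode guv.
  have : (g u).2 != (g v).2.
    apply: contraNneq uv => g2; apply/eqP/g_inj; rewrite ?AS //.
    by rewrite [g u]surjective_pairing guv g2 -surjective_pairing.
  by rewrite [RHS]surjective_pairing; case: (g u).2 (g v).2 => -[].
Qed.

(** For a clique [A] this is the vertex set of its link; for empty [A] it is all of [S], so the
    complex itself is treated as a link. *)
Definition common_nbhd A : {fset T} := [fset v in S | all (e^~ v) A].

Lemma in_common_nbhd A v :
  (v \in common_nbhd A) = (v \in S) && all (e^~ v) A.
Proof. by rewrite !inE. Qed.

Lemma common_nbhdU1 A v :
  nbhd e (common_nbhd A) v = common_nbhd (v |` A).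
Proof.
apply/fsetP => u; rewrite in_nbhd !in_common_nbhd -andbA; congr (_ && _).
apply/andP/allP => [[/allP Au evu] x|h]; first by rewrite !inE => /orP[/eqP->|/Au].
split; first by apply/allP => x xA; apply: h; rewrite !inE xA orbT.
by apply: h; rewrite !inE eqxx.
Qed.

Lemma clique_fsetU1 A v : A `<=` S -> clique A -> v \in common_nbhd A ->
  [/\ v |` A `<=` S, clique (v |` A) & #|` v |` A| = #|` A|.+1].
Proof.
rewrite in_common_nbhd => /fsubsetP AS clA /andP[vS /allP Av]; split.
- by apply/fsubsetP => u; rewrite !inE => /orP[/eqP->|/AS].
- move=> u w; rewrite !inE => /orP[/eqP->|uA] /orP[/eqP->|wA].
  + by rewrite eqxx.
  + by rewrite e_sym => _; apply: Av.
  + by move=> _; apply: Av.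
  + exact: clA.
- rewrite cardfsU1; case: (boolP (v \in A)) => // /Av.
  by rewrite e_irr.
Qed.

Lemma mem_common_nbhd A B v : face K B -> A `<=` B -> v \in B -> v \notin A ->
  v \in common_nbhd A.
Proof.
move=> /KS[_ /fsubsetP BS clB] /fsubsetP AB vB vA; rewrite in_common_nbhd BS //=.
apply/allP => u uA /=; apply: clB => //; first exact: AB.
by apply: contraNneq vA => <-.
Qed.

Lemma connected_from_complex (L : complex T) (N : {fset T}) :
  (forall v, vertices L v <-> v \in N) ->
  (forall u v, face L [fset u; v] -> u != v -> e u v) ->
  connected_complex L -> connected e N.
Proof.
move=> LN Ledge conL P [u uN Pu] step v vN.
have crt := conL u v (proj2 (LN u) uN) (proj2 (LN v) vN).
suff [] : P v /\ v \in N by [].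
elim: crt (conj Pu uN) => [x y xy [Px xN]|x //|x y z _ IH1 _ IH2 /IH1/IH2 //].
have yN : y \in N.
  apply/LN; apply: face_sub xy _ _; first by apply/fset0Pn; exists y; rewrite inE.
  by apply/fsubsetP => z; rewrite !inE => ->; rewrite orbT.
have [<-//|nxy] := eqVneq x y; split=> //.
exact: (step x y xN yN Px (Ledge x y xy nxy)).
Qed.

Lemma fdimS A d : A != fset0 -> (fdim A = d) <-> (#|` A| = d.+1).
Proof. by rewrite -cardfs_gt0 /fdim => A0; split; lia. Qed.

(** The number [r] is the dimension of the link of [A]. Adding a vertex to [A] lowers it by one,
    down to the faces of dimension d - 1, whose two facets give the two points of a 0-sphere. *)
Lemma locally_sphere_common_nbhd d r A : (2 <= d)%N -> normal_pseudomanifold d K ->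
  A `<=` S -> clique A -> (#|` A| + r = d)%N -> locally_sphere e r (common_nbhd A).
Proof.
move=> d2 [[[A0 [KA0 dimA0]] le_d] pureK conK two_facets linkK].
have KE B : B != fset0 -> B `<=` S -> clique B -> face K B by move=> *; apply/KS.
have nempty v B : v |` B != fset0 by apply/fset0Pn; exists v; rewrite !inE eqxx.
have face_card B : face K B -> (#|` B| <= d.+1)%N by move/le_d; rewrite /fdim; lia.
elim: r A => [|r IH] A AS clA cardA /=.
  have An0 : A != fset0 by rewrite -cardfs_gt0; lia.
  have KA : face K A by apply: KE.
  have [B1 [B2 [B12 facets]]] : exists B1 B2, B1 <> B2 /\
     forall B, [/\ face K B, fdim B = d & A `<=` B] <-> B = B1 \/ B = B2.
    by apply: two_facets; rewrite // /fdim prednK ?cardfs_gt0 //; lia.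
  have ext B : [/\ face K B, fdim B = d & A `<=` B] ->
      exists2 v, v \in common_nbhd A & B = v |` A.
    move=> [KB dB AB]; have Bn0 : B != fset0 by apply: face_neq0 KB.
    have cB : #|` B| = d.+1 by apply/fdimS.
    have : #|` B `\` A| = 1%N by rewrite cardfsD (fsetIidPr AB); lia.
    move/eqP/cardfs1P => [v vE].
    have : v \in B `\` A by rewrite vE inE.
    rewrite inE => /andP[vA vB].
    exists v; first exact: mem_common_nbhd KB AB vB vA.
    by rewrite -(fsetID A B) (fsetIidPr AB) vE fsetUC.
  have facet v : v \in common_nbhd A ->
      [/\ face K (v |` A), fdim (v |` A) = d & A `<=` v |` A].
    move=> vN; have [S1 cl1 c1] := clique_fsetU1 AS clA vN.
    split; [exact: KE| by apply/fdimS; rewrite // c1; lia | exact: fsubsetUr].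
  have notA v : v \in common_nbhd A -> v \notin A.
    rewrite in_common_nbhd => /andP[_ /allP h]; apply/negP => /h.
    by rewrite e_irr.
  have [v1 v1N E1] := ext B1 (proj2 (facets B1) (or_introl erefl)).
  have [v2 v2N E2] := ext B2 (proj2 (facets B2) (or_intror erefl)).
  have v12 : v1 != v2 by apply/eqP => v12; case: B12; rewrite E1 E2 v12.
  exists v1, v2; split=> //.
    (* Adjacent [v1] and [v2] would extend [A] to a clique, hence a face, with d + 2 vertices. *)
    apply/negP => e12; have [S1 cl1 c1] := clique_fsetU1 AS clA v1N.
    have v2N' : v2 \in common_nbhd (v1 |` A) by rewrite -common_nbhdU1 in_nbhd v2N.
    have [S2 cl2 c2] := clique_fsetU1 S1 cl1 v2N'.
    have := face_card _ (KE _ (nempty _ _) S2 cl2); rewrite c2 c1; lia.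
  apply/fsetP => v; rewrite !inE; apply/idP/idP; last first.
    by case/orP => /eqP->; rewrite -in_common_nbhd.
  rewrite -in_common_nbhd => vN; have vA := notA v vN.
  have := proj1 (facets _) (facet v vN).
  have : v \in v |` A by rewrite !inE eqxx.
  by move=> + [] vE; rewrite vE ?E1 ?E2 !inE (negPf vA) orbF => ->; rewrite ?orbT.
split; last first.
- move=> v vN; rewrite common_nbhdU1; have [S1 cl1 c1] := clique_fsetU1 AS clA vN.
  by apply: IH => //; lia.
- have [A00|An0] := eqVneq A fset0.
    apply: connected_from_complex conK.
      by move=> v; rewrite clique_complex_vertices in_common_nbhd A00 /= andbT.
    by move=> u v /KS[_ _ cl] uv; apply: cl; rewrite ?inE ?eqxx ?orbT.
  have KA := KE A An0 AS clA.
  apply: (@connected_from_complex (link K A)); last first.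
  + by apply: linkK; rewrite // /fdim; move: An0; rewrite -cardfs_gt0; lia.
  + move=> u v [_ _ /KS[_ _ cl]] uv.
    by apply: cl; rewrite ?inE ?eqxx ?orbT.
  + move=> v; split=> [[_ dis KAv]|vN].
      apply: mem_common_nbhd KAv _ _ _; first exact: fsubsetUl.
        by rewrite !inE eqxx orbT.
      by move/fdisjointP: dis => dis; apply/negP => /dis; rewrite inE eqxx.
    have [S1 cl1 c1] := clique_fsetU1 AS clA vN.
    split; [by apply/fset0Pn; exists v; rewrite inE | | by rewrite fsetUC; apply: KE].
    apply/fdisjointP => u uA; rewrite inE; apply/negP => /eqP uv.
    move: vN; rewrite in_common_nbhd => /andP[_ /allP/(_ u uA)].
    by rewrite uv e_irr.
- apply/negP => /eqP N0; have [A00|An0] := eqVneq A fset0.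
    have /fset0Pn[v vA0] := face_neq0 KA0.
    have [_ /fsubsetP A0S _] := proj1 (KS A0) KA0.
    have : v \in common_nbhd A by rewrite in_common_nbhd A00 A0S.
    by rewrite N0 inE.
  have KA := KE A An0 AS clA.
  (* With no common neighbour [A] would be maximal although it has fewer than d + 1 vertices,
     against purity. *)
  have : maximal_face K A.
    split=> // B KB AB; apply/eqP; rewrite eqEfsubset AB andbT.
    apply/fsubsetP => v vB; apply: contraT => vA.
    by have := mem_common_nbhd KB AB vB vA; rewrite N0 inE.
  by move/pureK/(fdimS _ An0); lia.
Qed.

Lemma normal_pseudomanifold_locally_sphere d : (2 <= d)%N ->
  normal_pseudomanifold d K -> locally_sphere e d S.
Proof.
move=> d2 npK.
have -> : S = common_nbhd fset0.
  by apply/fsetP => v; rewrite in_common_nbhd /= andbT.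
exact: (locally_sphere_common_nbhd d2 npK).
Qed.

End CliqueComplex.
End FlagComplexes.

(** * Rips complexes of planar sets as clique complexes *)

Section RipsGraph.
Variable R : realType.
Implicit Types (u v : 'rV[R]_2) (A : {fset 'rV[R]_2}).

Definition abscissa u : R := u ord0 ord0.
Definition ordinate u : R := u ord0 ord_max.

Lemma edist_lt1 u v : (edist u v < 1) = (sqdist abscissa ordinate u v < 1).
Proof.
rewrite /edist -[X in _ < X]sqrtr1 ltr_sqrt // big_ord_recl big_ord1.
rewrite /sqdist /abscissa /ordinate.
by have -> : lift ord0 ord0 = ord_max :> 'I_2 by apply: val_inj.
Qed.

Lemma edistxx u : edist u u = 0.
Proof. by rewrite /edist big1 ?sqrtr0 // => i _; rewrite subrr expr0n. Qed.

Lemma diam_lt1 A : diam A < 1 <-> forall u v, u \in A -> v \in A -> edist u v < 1.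
Proof.
rewrite /diam; split=> [dA u v uA vA|dA].
  apply: le_lt_trans dA; apply: (@bigmax_sup_seq _ _ _ _ _ u) => //.
  exact: (@bigmax_sup_seq _ _ _ _ _ v).
rewrite big_seq; apply: bigmax_lt => // u uA.
by rewrite big_seq; apply: bigmax_lt => // v vA; apply: dA.
Qed.

(** A bound on the diameter is a condition on pairs, so the Rips complex is flag, and induced
    subcomplexes inherit this. *)
Lemma rips_clique_complex (X : set 'rV[R]_2) (K : complex 'rV[R]_2) :
  finite_set X -> induced_subcomplex K (rips X) ->
  clique_complex (near abscissa ordinate) (fset_set (vertices K)) K.
Proof.
move=> finX [KX indK].
have finV : finite_set (vertices K).
  apply: sub_finite_set finX => v /KX[_ + _]; apply; by rewrite inE.
have inV v : v \in fset_set (vertices K) <-> vertices K v.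
  by rewrite in_fset_set //; split=> [/set_mem|/mem_set].
have clE A : clique (near abscissa ordinate) A <->
    forall u v, u \in A -> v \in A -> edist u v < 1.
  split=> [cl u v uA vA|dA u v uA vA uv].
    have [->|uv] := eqVneq u v; first by rewrite edistxx.
    by have := cl u v uA vA uv; rewrite nearE edist_lt1 => /andP[].
  by rewrite nearE uv -edist_lt1 dA.
move=> A; split=> [KA|[A0 /fsubsetP AV clA]].
  split; [exact: face_neq0 KA| |].
    apply/fsubsetP => v vA; apply/inV; apply: face_sub KA _ _.
      by apply/fset0Pn; exists v; rewrite inE.
    by apply/fsubsetP => u; rewrite inE => /eqP->.
  by have [_ _ /diam_lt1 dA] := KX A KA; apply/clE.
apply: indK => [|v vA]; last exact/inV/AV.
split=> // [v /AV/inV/KX[_ + _]|]; first by apply; rewrite inE.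
exact/diam_lt1/clE.
Qed.

End RipsGraph.

Theorem mainTheorem4 (R : realType) (X : set 'rV[R]_2) (hX : finite_set X)
    (d : nat) (hd : (2 <= d)%N) (K : complex 'rV[R]_2)
    (hK : normal_pseudomanifold d K)
    (hKX : induced_subcomplex K (rips X)) :
  isomorphic K (crosspolytope_boundary d.+1).
Proof.
have flagK := rips_clique_complex hX hKX.
have near_sym := @near_sym R _ (@abscissa R) (@ordinate R).
have near_irr := @near_irr R _ (@abscissa R) (@ordinate R).
have := normal_pseudomanifold_locally_sphere near_sym near_irr flagK hd hK.
case: d hd {hK} => [|[|d]] // _ /planar_sphere_cocktail_party[cp card].
exact: (cocktail_party_isomorphic near_sym near_irr flagK cp card).
Qed.
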